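(* If $G$ is a $K_5$ descendant, then $G$ has at least $4$ triangles, i.e. $\mathrm{tri}(G)\ge 4$.
   Context: Graphs are finite, simple and undirected. Double triangle expansion (DTE): let $G$ be a $4$-regular graph containing four distinct vertices $v_1,v_2,v_3,v_4$ such that $\{v_1,v_2,v_3\}$ is a triangle and $\{v_2,v_4\}$ is an edge. The DTE of $G$ at this triangle-and-edge subgraph is the graph obtained by subdividing the edges $\{v_1,v_3\}$ and $\{v_2,v_4\}$ and identifying the two new vertices; equivalently, delete the edges $\{v_1,v_3\}$ and $\{v_2,v_4\}$ and add one new vertex adjacent to exactly $v_1,v_2,v_3,v_4$. The result is again $4$-regular. A $K_5$ descendant is a graph (up to isomorphism) obtained from the complete graph $K_5$ by a finite (possibly empty) sequence of DTEs. $\mathrm{tri}(G)$ denotes the number of triangles ($3$-cycle subgraphs) of $G$. *)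

(* Defs.v *)
From mathcomp Require Import all_boot.

Set Implicit Arguments.
Unset Strict Implicit.
Unset Printing Implicit Defensive.

Record sgraph := SGraph {
  vertex :> finType;
  adj : rel vertex;
  adj_sym : symmetric adj;
  adj_irrefl : irreflexive adj
}.

Definition isomorphic (G H : sgraph) : Prop :=
  exists2 f : G -> H, bijective f & forall x y : G, adj (f x) (f y) = adj x y.

Definition regular (k : nat) (G : sgraph) : Prop :=
  forall x : G, #|[set y | adj x y]| = k.

Definition is_triangle (G : sgraph) (t : {set G}) : bool :=
  (#|t| == 3) && [forall x in t, forall y in t, (x != y) ==> adj x y].

Definition tri (G : sgraph) : nat := #|[set t : {set G} | is_triangle t]|.

Fact neq_sym (T : eqType) : symmetric (fun x y : T => x != y).
Proof. by move=> x y; rewrite eq_sym. Qed.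

Fact neq_irrefl (T : eqType) : irreflexive (fun x y : T => x != y).
Proof. by move=> x; rewrite eqxx. Qed.

Definition complete_graph (n : nat) : sgraph :=
  SGraph (@neq_sym 'I_n) (@neq_irrefl 'I_n).

Section DoubleTriangleExpansion.
Variables (G : sgraph) (v1 v2 v3 v4 : G).

Definition dte_site : Prop :=
  [/\ uniq [:: v1; v2; v3; v4],
      [&& adj v1 v2, adj v2 v3 & adj v1 v3]
    & adj v2 v4].

(* None is the new vertex; Some embeds the vertices of G. *)
Definition dte_adj : rel (option G) := fun x y =>
  match x, y with
  | Some a, Some b =>
      [&& adj a b, [set a; b] != [set v1; v3] & [set a; b] != [set v2; v4]]
  | Some a, None | None, Some a => a \in [set v1; v2; v3; v4]
  | None, None => false
  end.

Fact dte_adj_sym : symmetric dte_adj.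
Proof. by move=> [a|] [b|] //=; rewrite adj_sym setUC. Qed.

Fact dte_adj_irrefl : irreflexive dte_adj.
Proof. by move=> [a|] //=; rewrite adj_irrefl. Qed.

Definition dte : sgraph := SGraph dte_adj_sym dte_adj_irrefl.

End DoubleTriangleExpansion.

Inductive K5_descendant : sgraph -> Prop :=
| K5_descendant_base : K5_descendant (complete_graph 5)
| K5_descendant_dte (G : sgraph) (v1 v2 v3 v4 : G) :
    K5_descendant G -> regular 4 G -> dte_site v1 v2 v3 v4 ->
    K5_descendant (dte v1 v2 v3 v4)
| K5_descendant_iso (G H : sgraph) :
    K5_descendant G -> isomorphic G H -> K5_descendant H.

(* Main.v *)
Require Import Defs.
From mathcomp Require Import all_boot.
From mathcomp Require Import zify.

Set Implicit Arguments.
Unset Strict Implicit.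
Unset Printing Implicit Defensive.

(** The heart of the matter is a statement about edge cuts.  In a K5 descendant,
    every set [A] of at least four vertices, with at least three vertices
    outside, that is joined to its complement by at most six edges contains two
    triangles ([rich_sides]).  Four triangles follow.  A descendant contains
    two triangles on a common edge; in a 4-regular graph their four vertices
    form a set [D] with at most six outgoing edges.  If there are at least
    eight vertices, the complement of [D] is large enough to contain two
    further triangles.  On at most seven vertices any two neighbourhoods of
    size four meet, so every edge lies in a triangle, and the at least ten
    edges need at least four triangles.

    The cut statement survives an expansion for counting reasons.  Let [n] be
    the new vertex, [A] a set in the expanded graph, and compare it with its
    trace [old A] in the original graph.  Formula [cut_dte] expresses the
    difference of the two cuts by the sides on which [n, v1, v2, v3, v4] lie.
    Outside of three situations it provides a cut of at most four edges with
    two vertices on each side of the original graph, which cannot exist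
    ([small_cuts_trivial], itself preserved by expansions).  The three
    situations are these: [A] contains neither deleted edge, and then the
    triangles in [old A] survive; or [A] contains [v1, v2, v3, n], which carry
    two triangles; or [A] contains [v2, v4, n] and exactly one of [v1, v3], and
    then triangles through [n] make up for those lost with the edge [v2 v4]
    ([two_tri_shift]).

    Sets of exactly four vertices need no induction, since at most six outgoing
    edges force five inner edges ([two_tri_card4]).  Thus [A] may be assumed to
    have five vertices, which leaves room for dropping one of them when the
    trace of the complement is too small for the induction hypothesis
    ([two_tri_new_notin]). *)

(** * Edge cuts in 4-regular graphs *)

Section Cuts.
Variable G : sgraph.
Implicit Types (A B : {set G}) (x y r : G).

Definition edges A B : nat := \sum_(x in A) \sum_(y in B) adj x y.
Definition cut A : nat := edges A (~: A).

Lemma edges_sum A B :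
  edges A B = \sum_x \sum_y [&& x \in A, y \in B & adj x y].
Proof.
rewrite /edges big_mkcond; apply: eq_bigr => x _.
case: (x \in A); last by rewrite big1.
by rewrite big_mkcond; apply: eq_bigr => y _; case: (y \in B).
Qed.

Lemma adj_neq x y : adj x y -> x != y.
Proof. by apply: contraTneq => ->; rewrite adj_irrefl. Qed.

Lemma edgesC A B : edges A B = edges B A.
Proof.
rewrite /edges exchange_big /=; apply: eq_bigr => x _; apply: eq_bigr => y _.
by rewrite adj_sym.
Qed.

Lemma cutC A : cut (~: A) = cut A.
Proof. by rewrite /cut setCK edgesC. Qed.

Lemma cut0 : cut set0 = 0.
Proof. by rewrite /cut /edges big_set0. Qed.

Lemma edgesU1 r A B :
  r \notin A -> edges (r |: A) B = edges [set r] B + edges A B.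
Proof. by move=> rA; rewrite /edges big_setU1 // big_set1. Qed.

Lemma edges_setC A B : edges A B + edges A (~: B) = edges A [set: G].
Proof.
rewrite /edges -big_split; apply: eq_bigr => x _ /=.
rewrite [RHS](bigID (mem B)) /=.
by congr (_ + _); apply: eq_bigl => y; rewrite !inE.
Qed.

Lemma edges1 r B : edges [set r] B = #|[set y in B | adj r y]|.
Proof.
rewrite /edges big_set1 -sum1_card [RHS]big_mkcond /= big_mkcond /=.
by apply: eq_bigr => y _; rewrite inE; case: (y \in B); case: (adj r y).
Qed.

Lemma edges1_ge r B s :
  uniq s -> all (fun y => (y \in B) && adj r y) s -> size s <= edges [set r] B.
Proof.
move=> us /allP sB; rewrite edges1; apply/card_geqP; exists s; split=> // y ys.
by rewrite inE sB.
Qed.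

Lemma cut1 r : cut [set r] = #|[set y | adj r y]|.
Proof.
rewrite /cut edges1; apply: eq_card => y; rewrite !inE.
by case: eqP => [->|]; rewrite ?adj_irrefl.
Qed.

Lemma edges_inner A : edges A A <= #|A| * #|A|.-1.
Proof.
rewrite -sum_nat_const; apply: leq_sum => x xA.
have -> : #|A|.-1 = #|A :\ x| by rewrite (cardsD1 x A) xA.
rewrite (bigD1 x) //= adj_irrefl add0n -sum1_card.
rewrite big_mkcond [leqRHS]big_mkcond; apply: leq_sum => y _ /=.
by rewrite !inE andbC; case: (_ && _); case: (adj x y).
Qed.

Section Regular.
Hypothesis regG : regular 4 G.

Lemma edgesT A : edges A [set: G] = 4 * #|A|.
Proof.
rewrite mulnC -sum_nat_const; apply: eq_bigr => x _.
rewrite -(big_set1 addn x (fun x => \sum_(y in [set: G]) adj x y)) -/(edges _ _).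
by rewrite edges1 -(regG x); apply: eq_card => y; rewrite !inE.
Qed.

Lemma cut_inner A : cut A + edges A A = 4 * #|A|.
Proof. by rewrite -edgesT -(edges_setC A A) addnC. Qed.

Lemma cut_card2 A : #|A| = 2 -> 6 <= cut A.
Proof.
by move=> A2; have := cut_inner A; have := edges_inner A; rewrite A2; lia.
Qed.

(** Moving [r] across turns its edges to [B] from cut edges into inner edges
    and its remaining edges, out of four, into cut edges. *)
Lemma cut_move r B :
  r \notin B -> cut (r |: B) + 2 * edges [set r] B = cut B + 4.
Proof.
move=> rB.
have := cut_inner (r |: B); have := cut_inner B; have := edgesU1 (r |: B) rB.
have := edgesU1 [set r] rB; rewrite edgesC.
have := edgesU1 B rB; have := edgesC B (r |: B); have := edgesC B [set r].
have r0 : edges [set r] [set r] = 0.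
  by rewrite /edges !big_set1 adj_irrefl.
have := cardsU1 r B; rewrite rB r0 => ->; lia.
Qed.

Lemma cut_move_le r B s : r \notin B -> uniq s ->
  all (fun y => (y \in B) && adj r y) s ->
  cut (r |: B) + 2 * size s <= cut B + 4.
Proof.
by move=> rB us sB; rewrite -(cut_move rB) leq_add2l leq_mul2l edges1_ge.
Qed.
End Regular.

(** * Triangles inside a vertex set *)

Definition tri_in A : nat := #|[set t : {set G} | is_triangle t & t \subset A]|.

Lemma tri_in_subset A B : A \subset B -> tri_in A <= tri_in B.
Proof.
move=> sAB; apply: subset_leq_card; apply/subsetP => t.
by rewrite !inE => /andP[-> /subset_trans->].
Qed.

Lemma card_triangle (t : {set G}) : is_triangle t -> #|t| = 3.
Proof. by case/andP => /eqP. Qed.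

Lemma triangle_adj (t : {set G}) x y :
  is_triangle t -> x \in t -> y \in t -> x != y -> adj x y.
Proof.
case/andP => _ /forall_inP tt xt yt.
by have /forall_inP/(_ _ yt)/implyP := tt x xt.
Qed.

Lemma is_triangle3 x y z :
  adj x y -> adj y z -> adj x z -> is_triangle [set x; y; z].
Proof.
move=> xy yz xz; have [yx zy zx] : [/\ adj y x, adj z y & adj z x].
  by rewrite ![adj z _]adj_sym adj_sym.
apply/andP; split.
  by rewrite setUC cardsU1 cards2 !inE negb_or !adj_neq.
apply/forall_inP => a; rewrite !inE => /orP[/orP[]|] /eqP->;
  apply/forall_inP => b; rewrite !inE => /orP[/orP[]|] /eqP->;
  by apply/implyP; rewrite // eqxx.
Qed.

Lemma triangle_third (t : {set G}) x y : is_triangle t ->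
  x \in t -> y \in t -> x != y ->
  exists z, [/\ z != x, z != y, adj x z & t = [set x; y; z]].
Proof.
move=> tt xt yt xy; have := card_triangle tt.
rewrite (cardsD1 x) xt (cardsD1 y) !inE eq_sym xy yt => -[] /eqP/cards1P[z Ez].
have : z \in t :\ x :\ y by rewrite Ez set11.
rewrite !inE => /and3P[zy zx zt]; exists z; split=> //.
  by apply: triangle_adj tt xt zt _; rewrite eq_sym.
apply/esym/eqP; rewrite eqEcard !subUset !sub1set xt yt zt (card_triangle tt).
by rewrite setUC cardsU1 cards2 !inE negb_or zx zy xy.
Qed.

(** [p] and [q] span the common edge. *)
Definition double_triangle p q r s : Prop :=
  [/\ adj p q, adj p r, adj q r, adj p s & adj q s] /\ r != s.

Lemma two_triangles A p q r s : double_triangle p q r s ->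
  [&& p \in A, q \in A, r \in A & s \in A] -> 1 < tri_in A.
Proof.
move=> [[pq pr qr ps qs] rs] /and4P[pA qA rA sA]; apply/card_gt1P.
exists [set p; q; r], [set p; q; s]; split.
- by rewrite inE is_triangle3 //= !subUset !sub1set pA qA rA.
- by rewrite inE is_triangle3 //= !subUset !sub1set pA qA sA.
apply/eqP => /setP/(_ r); rewrite !inE eqxx orbT (negPf rs) ![r == _]eq_sym.
by rewrite (negPf (adj_neq pr)) (negPf (adj_neq qr)).
Qed.

(** The four vertices are collected one by one: the second has one neighbour
    among the previous ones, the third and the fourth have two, so that the
    cut sizes are at most 4, 6, 6 and 6. *)
Lemma cut_double_triangle p q r s : regular 4 G -> double_triangle p q r s ->
  exists2 D : {set G}, [&& p \in D, q \in D, r \in D & s \in D] &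
    #|D| = 4 /\ cut D <= 6.
Proof.
move=> regG [[pq pr qr ps qs] rs].
have [qp rp rq sp sq] : [/\ adj q p, adj r p, adj r q, adj s p & adj s q].
  by split; rewrite adj_sym.
pose B1 := [set p]; pose B2 := q |: B1; pose B3 := r |: B2; pose D := s |: B3.
have q1 : q \notin B1 by rewrite !inE adj_neq.
have r2 : r \notin B2 by rewrite !inE negb_or !adj_neq.
have s3 : s \notin B3 by rewrite !inE !negb_or eq_sym rs !adj_neq.
exists D; first by rewrite !inE !eqxx !orbT.
split; first by rewrite !cardsU1 s3 r2 q1 cards1.
have u1 : uniq [:: p] by [].
have u2 : uniq [:: p; q] by rewrite /= inE adj_neq.
have c1 : cut B1 = 4 by rewrite cut1 regG.
have /= c2 := cut_move_le regG q1 u1 ltac:(by rewrite /= !inE eqxx qp).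
have /= c3 := cut_move_le regG r2 u2 ltac:(by rewrite /= !inE !eqxx orbT rp rq).
have /= c4 := cut_move_le regG s3 u2 ltac:(by rewrite /= !inE !eqxx !orbT sp sq).
move: c1 c2 c3 c4; rewrite -/B2 -/B3 -/D; clear; lia.
Qed.

(** Sixteen edge ends minus at most six outgoing ones leave five inner edges,
    hence at most one missing pair; the two other vertices span an edge that
    lies in two triangles. *)
Lemma two_tri_card4 A : regular 4 G -> #|A| = 4 -> cut A <= 6 -> 1 < tri_in A.
Proof.
move=> regG A4 cA; have := cut_inner regG A; rewrite A4.
have := cardE A; rewrite A4; have := enum_uniq A; have := @mem_enum _ A.
rewrite /edges -big_enum /=.
under eq_bigr => x _ do rewrite -big_enum /=.
case: (enum A) => [|a [|b [|c [|d [|]]]]] //= mA ud _.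
have {}mA : all [in A] [:: a; b; c; d] by apply/allP => x; rewrite -mA.
move: mA ud; rewrite /= !inE !negb_or => /and5P[aA bA cA' dA _].
case/and4P => /and3P[ab ac ad] /andP[bc bd] cd _.
(* Only one orientation of each pair is kept, to reason on six booleans. *)
have [ba ca da] : [/\ adj b a = adj a b, adj c a = adj a c & adj d a = adj a d].
  by split; exact: adj_sym.
have [cb db dc] : [/\ adj c b = adj b c, adj d b = adj b d & adj d c = adj c d].
  by split; exact: adj_sym.
rewrite !big_cons !big_nil !adj_irrefl ba ca da cb db dc => E.
have T p q r s h n := @two_triangles A p q r s (conj h n).
case Eab: (adj a b) E; case Eac: (adj a c); case Ead: (adj a d);
case Ebc: (adj b c); case Ebd: (adj b d); case Ecd: (adj c d) => /= E;
try (exfalso; move: E cA; clear; lia).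
all: have R := (ba, ca, da, cb, db, dc, (aA, bA, cA', dA),
                (Eab, Eac, Ead, Ebc, Ebd, Ecd)).
all: first
  [ by apply: (T c d a b); rewrite ?R | by apply: (T b d a c); rewrite ?R
  | by apply: (T b c a d); rewrite ?R | by apply: (T a d b c); rewrite ?R
  | by apply: (T a c b d); rewrite ?R | by apply: (T a b c d); rewrite ?R ].
Qed.

Lemma tri_in_disjoint A : tri_in A + tri_in (~: A) <= tri G.
Proof.
rewrite -cardsUI; set I := _ :&: _; have -> : I = set0.
  apply/setP => t; rewrite !inE; apply/negP => /andP[/andP[tt tA] /andP[_ tA']].
  have := card_triangle tt; suff -> : t = set0 by rewrite cards0.
  by apply/eqP; rewrite -subset0 -(setICr A) subsetI tA.
rewrite cards0 addn0; apply: subset_leq_card; apply/subsetP => t.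
by rewrite !inE => /orP[] /andP[].
Qed.

End Cuts.

Lemma imset_triangle (G H : sgraph) (g : G -> H) (t : {set G}) :
  injective g -> {in t &, forall x y, adj x y -> adj (g x) (g y)} ->
  is_triangle t -> is_triangle (g @: t).
Proof.
move=> inj_g gadj tt; apply/andP; split.
  by rewrite card_imset // card_triangle.
apply/forall_inP => _ /imsetP[x xt ->]; apply/forall_inP => _ /imsetP[y yt ->].
rewrite (inj_eq inj_g); apply/implyP => xy.
exact: gadj (triangle_adj tt xt yt xy).
Qed.

Lemma tri_in_imset (G H : sgraph) (g : G -> H) (A : {set G}) (B : {set H}) :
  injective g ->
  (forall t : {set G}, is_triangle t -> t \subset A -> is_triangle (g @: t)) ->
  g @: A \subset B -> tri_in A <= tri_in B.
Proof.
move=> inj_g gtri gAB.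
set T := [set t : {set G} | is_triangle t & t \subset A].
have <- : #|[set g @: t | t : {set G} in T]| = tri_in A.
  by rewrite card_imset //; exact: imset_inj.
apply: subset_leq_card.
apply/subsetP => _ /imsetP[t tA ->]; move: tA; rewrite !inE => /andP[tt tA].
rewrite gtri //=.
exact: subset_trans (imsetS g tA) gAB.
Qed.

(** * The invariant *)

Definition small_cuts_trivial (G : sgraph) :=
  forall A : {set G}, cut A <= 4 -> #|A| <= 1 \/ #|~: A| <= 1.

(** The bound on the complement lets it keep two vertices when the new vertex
    is taken away or one vertex is moved across, so that [small_cuts_trivial]
    excludes the resulting cuts of at most four edges. *)
Definition rich_sides (G : sgraph) :=
  forall A : {set G}, 4 <= #|A| -> 3 <= #|~: A| -> cut A <= 6 -> 1 < tri_in A.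

Record sturdy (G : sgraph) : Prop := Sturdy {
  sturdy_regular : regular 4 G;
  sturdy_double : exists p q r s : G, double_triangle p q r s;
  sturdy_cuts : small_cuts_trivial G;
  sturdy_rich : rich_sides G
}.

Lemma sturdy_iso (G H : sgraph) : isomorphic G H -> sturdy G -> sturdy H.
Proof.
move=> [f bij_f fadj] [regG [p [q [r [s pqrs]]]] cutG richG].
have inj_f := bij_inj bij_f.
have cut_f (A : {set H}) : cut (f @^-1: A) = cut A.
  rewrite /cut /edges [RHS](reindex f) /=; last exact: onW_bij.
  apply: eq_big => [x|x _]; first by rewrite inE.
  rewrite [RHS](reindex f) /=; last exact: onW_bij.
  by apply: eq_big => [y|y _]; rewrite ?inE ?fadj.
have card_f (A : {set H}) : #|f @^-1: A| = #|A|.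
  apply: on_card_preimset; exact: onW_bij.
have cardC_f (A : {set H}) : #|~: (f @^-1: A)| = #|~: A|.
  by rewrite -preimsetC card_f.
split.
- move=> y; rewrite -cut1 -cut_f; have [g fK gK] := bij_f.
  have -> : f @^-1: [set y] = [set g y].
    by apply/setP => x; rewrite !inE -{1}(gK y) (inj_eq inj_f).
  by rewrite cut1.
- exists (f p), (f q), (f r), (f s).
  by rewrite /double_triangle !fadj (inj_eq inj_f).
- by move=> A; rewrite -cut_f -card_f -cardC_f; apply: cutG.
move=> A A4 A3 cA; apply: leq_trans (richG (f @^-1: A) _ _ _) _;
  rewrite ?card_f ?cardC_f ?cut_f //.
apply: (tri_in_imset inj_f) => [t tt _|]; last first.
  by apply/subsetP => _ /imsetP[x /[!inE] fx ->].
by apply: imset_triangle => // x y _ _; rewrite fadj.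
Qed.

Lemma sturdy_K5 : sturdy (complete_graph 5).
Proof.
have reg : regular 4 (complete_graph 5).
  move=> x; transitivity #|[set~ x]|; last by rewrite cardsC1 card_ord.
  by apply: eq_card => y; rewrite !inE eq_sym.
split=> //.
- by exists (inord 0), (inord 1), (inord 2), (inord 3); split; [split|];
    rewrite /= -val_eqE /= !inordK.
- move=> A; have := cut_inner reg A; have := edges_inner A; have := cardsC A.
  rewrite card_ord; case: #|A| => [|[|[|[|[|[|]]]]]] /=; lia.
- by move=> A A4 A3; have := cardsC A; rewrite card_ord; lia.
Qed.

Lemma pair_eq (T : finType) (x y a b : T) : a != b ->
  ([set x; y] == [set a; b]) = (x == a) && (y == b) || (x == b) && (y == a).
Proof.
move=> ab; apply/eqP/idP => [E|]; last first.
  by case/orP => /andP[/eqP-> /eqP->] //; rewrite setUC.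
have := set21 x y; rewrite E => xab.
move: (set21 a b) (set22 a b) xab; rewrite -{1 2}E !inE.
rewrite ![a == _]eq_sym ![b == _]eq_sym.
case: (eqVneq x a) => [->|_] /=; first by rewrite (negPf ab) => _ /= ->.
by move=> -> _ ->.
Qed.

Lemma sum_option (T : finType) (F : option T -> nat) :
  \sum_x F x = F None + \sum_x F (Some x).
Proof.
rewrite (bigD1 None) //=; congr (_ + _).
rewrite (reindex_omap Some id) /=; last by case.
by apply: eq_bigl => x; rewrite eqxx.
Qed.

(** * Double triangle expansion *)

Section Expansion.
Variables (G : sgraph) (v1 v2 v3 v4 : G).
Hypotheses (stG : sturdy G) (site : dte_site v1 v2 v3 v4).
Local Notation H := (dte v1 v2 v3 v4).
Let regG := sturdy_regular stG.
Implicit Types A : {set H}.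

Lemma site_neq :
  [/\ v1 != v2, v1 != v3, v1 != v4 & [/\ v2 != v3, v2 != v4 & v3 != v4]].
Proof.
have [+ _ _] := site; rewrite /= !inE !negb_or.
by case/and4P => /and3P[-> -> ->] /andP[-> ->] -> _.
Qed.

(** The trace of [A] on the graph before the expansion. *)
Definition old A : {set G} := [set x | Some x \in A].

Lemma old_setC A : old (~: A) = ~: old A.
Proof. by apply/setP => x; rewrite !inE. Qed.

Lemma card_old A : #|A| = (None \in A) + #|old A|.
Proof.
rewrite -!sum1_card big_mkcond sum_option [X in _ = _ + X]big_mkcond /=.
by congr (_ + _); apply: eq_bigr => x _; rewrite inE.
Qed.

(** Each edge [Some vi -- None] of the new graph crosses the cut when [vi] and
    [None] lie on different sides, and each of the deleted edges [v1 v3] and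
    [v2 v4] crossed the old cut when its ends lie on different sides. *)
Lemma cut_dte A :
  cut A + ((v1 \in old A) (+) (v3 \in old A))
    + ((v2 \in old A) (+) (v4 \in old A))
  = cut (old A) + ((None \in A) (+) (v1 \in old A))
    + ((None \in A) (+) (v2 \in old A)) + ((None \in A) (+) (v3 \in old A))
    + ((None \in A) (+) (v4 \in old A)).
Proof.
pose b v := v \in old A; pose c := None \in A.
rewrite -/c -!/(b _).
have cutE (K : sgraph) (B : {set K}) :
    cut B = \sum_x \sum_y [&& x \in B, y \notin B & adj x y].
  rewrite /cut edges_sum; apply: eq_bigr => x _; apply: eq_bigr => y _.
  by rewrite inE.
have [n12 n13 n14 [n23 n24 n34]] := site_neq.
have [_ /and3P[a12 a23 a13] a24] := site.
have sum1 (P : pred G) v : \sum_x (P x && (x == v)) = P v.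
  rewrite (bigD1 v) //= eqxx andbT big1 ?addn0 // => x /negPf->.
  by rewrite andbF.
have sum4 (P : pred G) :
    \sum_x (P x && (x \in [set v1; v2; v3; v4])) = P v1 + P v2 + P v3 + P v4.
  rewrite -!sum1 -!big_split; apply: eq_bigr => x _ /=; rewrite !inE.
  case: (P x) => //=; case: (eqVneq x v1) => [->|_].
    by rewrite (negPf n12) (negPf n13) (negPf n14).
  case: (eqVneq x v2) => [->|_]; first by rewrite (negPf n23) (negPf n24).
  by case: (eqVneq x v3) => [->|_] //; rewrite (negPf n34).
have sum2 (P : rel G) u v :
    \sum_x \sum_y (P x y && ((x == u) && (y == v))) = P u v.
  rewrite -(sum1 (P^~ v) u); apply: eq_bigr => x _.
  rewrite -(sum1 (fun y => P x y && (x == u))); apply: eq_bigr => y _.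
  by rewrite -andbA.
have sum_pair (u v : G) : u != v ->
    \sum_x \sum_y [&& x \in old A, y \notin old A & [set x; y] == [set u; v]]
    = b u (+) b v.
  move=> uv; set P : rel G := fun x y => (x \in old A) && (y \notin old A).
  transitivity (P u v + P v u); last by rewrite /P /b; do 2!case: (_ \in _).
  rewrite -!sum2 -big_split; apply: eq_bigr => x _.
  rewrite -big_split; apply: eq_bigr => y _ /=; rewrite pair_eq // andbA -/(P x y).
  case: (P x y) => //=; case: (eqVneq x u) => [->|_] //=.
  by rewrite (negPf uv) orbF addn0.
rewrite !cutE sum_option sum_option /=.
rewrite [X in _ + X + _ + _ = _](eq_bigr (fun x =>
    ((x \in old A) && ~~ c) && (x \in [set v1; v2; v3; v4]) +
    \sum_y [&& x \in old A, y \notin old A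
             & dte_adj v1 v2 v3 v4 (Some x) (Some y)])); last first.
  move=> x _; apply: etrans (sum_option _) _ => /=.
  rewrite !inE andbA; congr (_ + _).
  by apply: eq_bigr => y _; rewrite !inE.
rewrite big_split /= sum4.
rewrite [X in _ + X + _ + _ + _ = _](eq_bigr (fun x =>
    nat_of_bool (((x \notin old A) && c) && (x \in [set v1; v2; v3; v4]))));
  last by move=> x _; rewrite !inE -/c; case: c; rewrite /= ?andbT ?andbF.
rewrite sum4 -/(b _).
have -> : \sum_x \sum_y [&& x \in old A, y \notin old A & adj x y] =
    \sum_x \sum_y [&& x \in old A, y \notin old A
                    & dte_adj v1 v2 v3 v4 (Some x) (Some y)] +
    (b v1 (+) b v3) + (b v2 (+) b v4).
  rewrite -!sum_pair // -!big_split; apply: eq_bigr => x _.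
  rewrite -!big_split; apply: eq_bigr => y _ /=.
  case: (x \in old A) => //; case: (y \in old A) => //=.
  have e13 : [set x; y] = [set v1; v3] -> adj x y.
    move/eqP; rewrite pair_eq // => /orP[]/andP[/eqP-> /eqP->] //.
    by rewrite adj_sym.
  have e24 : [set x; y] = [set v2; v4] -> adj x y.
    move/eqP; rewrite pair_eq // => /orP[]/andP[/eqP-> /eqP->] //.
    by rewrite adj_sym.
  case: (eqVneq [set x; y]) e13 => [-> /(_ erefl)-> /=|_ _].
    rewrite pair_eq // (negPf n12); case: (eqVneq v1 v4) n14 => //.
  case: (eqVneq [set x; y]) e24 => [-> /(_ erefl)-> //|_ _].
  by rewrite andbT !addn0.
move: (\sum_x \sum_y _) => K; rewrite -/c -!/(b _) /=.
move: (b v1) (b v2) (b v3) (b v4) => b1 b2 b3 b4; move: c => c'; clear.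
move: c' b1 b2 b3 b4 => [] [] [] [] [] /=; lia.
Qed.

Lemma dte_regular : regular 4 H.
Proof.
have [n12 n13 n14 [n23 n24 n34]] := site_neq.
(* A degree is the cut of a singleton. *)
move=> x; rewrite -cut1; have := cut_dte [set x].
case: x => [a|].
  have -> : old [set Some a] = [set a].
    by apply/setP => y; rewrite !inE (inj_eq Some_inj).
  rewrite (cut1 a) regG !inE ![_ == a]eq_sym /=.
  case: (eqVneq a v1) => [->|_].
    by rewrite (negPf n12) (negPf n13) (negPf n14) /=; lia.
  case: (eqVneq a v2) => [->|_].
    by rewrite (negPf n23) (negPf n24) /=; lia.
  case: (eqVneq a v3) => [->|_]; first by rewrite (negPf n34) /=; lia.
  by case: (a == v4) => /=; lia.
have -> : old [set None] = set0 by apply/setP => y; rewrite !inE.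
by rewrite cut0 !inE /=; lia.
Qed.

Lemma cardC_old A : #|~: A| = (None \notin A) + #|~: old A|.
Proof. by rewrite card_old old_setC inE. Qed.

(** Cuts never shrink, so the old cut is trivial; a side that consists of the
    new vertex and one old vertex has at least six outgoing edges. *)
Lemma dte_small_cuts_trivial : small_cuts_trivial H.
Proof.
move=> A cA; have A2 := @cut_card2 _ dte_regular A.
have := @cut_card2 _ dte_regular (~: A); rewrite cutC.
have := cut_dte A; have := card_old A; have := cardC_old A.
have c0 : cut (old A) <= 4.
  have := cut_dte A; move: (v1 \in _) (v2 \in _) (v3 \in _) (v4 \in _) (None \in _).
  move: cA; clear; move: (cut _) (cut _) => X Y cX; do 5!case; rewrite /=; lia.
move=> -> cA' _; rewrite cA' in A2 *; case: (sturdy_cuts stG c0) => le1.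
  case: (None \in A) A2 => /=; lia.
case: (None \in A) => /=; lia.
Qed.

Lemma dte_adj_old x y : adj x y ->
  ~~ ((x \in [set v1; v3]) && (y \in [set v1; v3])) ->
  ~~ ((x \in [set v2; v4]) && (y \in [set v2; v4])) ->
  adj (Some x : H) (Some y : H).
Proof.
move=> xy n13 n24; apply/and3P; split=> //.
  by apply: contra n13 => /eqP<-; rewrite set21 set22.
by apply: contra n24 => /eqP<-; rewrite set21 set22.
Qed.

Lemma triangle_old (t : {set G}) : is_triangle t ->
  ~~ ((v1 \in t) && (v3 \in t)) -> ~~ ((v2 \in t) && (v4 \in t)) ->
  is_triangle (Some @: t : {set H}).
Proof.
move=> tt n13 n24; apply: imset_triangle tt; first exact: Some_inj.
move=> x y xt yt xy; have nxy := adj_neq xy; apply: dte_adj_old xy _ _.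
  apply: contra n13; rewrite !inE => /andP[/orP[]/eqP ex /orP[]/eqP ey];
  by move: nxy xt yt; rewrite ex ey ?eqxx // => _ -> ->.
apply: contra n24; rewrite !inE => /andP[/orP[]/eqP ex /orP[]/eqP ey];
  by move: nxy xt yt; rewrite ex ey ?eqxx // => _ -> ->.
Qed.

(** Triangles in a set that contains neither deleted edge survive. *)
Lemma tri_in_old A (B : {set G}) : B \subset old A ->
  ~~ ((v1 \in B) && (v3 \in B)) -> ~~ ((v2 \in B) && (v4 \in B)) ->
  tri_in B <= tri_in A.
Proof.
move=> /subsetP BA n13 n24; apply: (@tri_in_imset _ H Some) Some_inj _ _.
  move=> t tt /subsetP tB; apply: triangle_old => //.
    by apply: contra n13 => /andP[/tB-> /tB->].
  by apply: contra n24 => /andP[/tB-> /tB->].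
by apply/subsetP => _ /imsetP[x /BA xA ->]; rewrite inE in xA.
Qed.

Lemma dte_double_triangle :
  @double_triangle H (Some v2) None (Some v1) (Some v3).
Proof.
have [n12 n13 n14 [n23 n24 n34]] := site_neq.
have [_ /and3P[a12 a23 _] _] := site.
split; last by rewrite (inj_eq Some_inj).
split.
- by rewrite /= !inE eqxx ?orbT.
- apply: dte_adj_old; rewrite 1?adj_sym // !inE.
    by rewrite [v2 == v1]eq_sym (negPf n12) (negPf n23).
  by rewrite (negPf n12) (negPf n14) andbF.
- by rewrite /= !inE eqxx.
- apply: dte_adj_old => //; rewrite !inE.
    by rewrite [v2 == v1]eq_sym (negPf n12) (negPf n23).
  by rewrite [v3 == v2]eq_sym (negPf n23) (negPf n34) andbF.
by rewrite /= !inE eqxx !orbT.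
Qed.

(** A triangle in [old A] that is lost contains [v2] and [v4]. The triangle
    [q, v2, n] is new, so a second one is needed only if two triangles are
    lost, say with third vertices [x1] and [x2].  The four neighbours of [v2]
    include [p, q, v4], and [p] lies outside, so [q] is one of [x1, x2]; then
    [q v4] is an edge and [q, v4, n] is a triangle. *)
Lemma two_tri_shift A p q : [set p; q] = [set v1; v3] -> p \notin old A ->
  [&& q \in old A, v2 \in old A & v4 \in old A] -> None \in A ->
  1 < tri_in (old A) -> 1 < tri_in A.
Proof.
move=> pq pA /and3P[qA v2A v4A] nA /card_gt1P[t1 [t2] [t1A t2A t12]].
have [n12 n13 n14 [n23 n24 n34]] := site_neq.
have [_ /and3P[a12 a23 a13] a24] := site.
have [mp mq] : p \in [set v1; v3] /\ q \in [set v1; v3] by rewrite -pq set21 set22.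
have v4_13 : v4 \notin [set v1; v3].
  by rewrite !inE negb_or [v4 == _]eq_sym n14 eq_sym.
have v2_13 : v2 \notin [set v1; v3].
  by rewrite !inE negb_or eq_sym n12.
have a2 x : x \in [set v1; v3] -> adj v2 x.
  by rewrite !inE => /orP[]/eqP-> //; rewrite adj_sym.
have neq_in (x y : G) (B : {set G}) : x \in B -> y \notin B -> x != y.
  by move=> xB; apply: contraNneq => <-.
have qp := neq_in _ _ _ qA pA; have q2 := neq_in _ _ _ mq v2_13.
have q4 := neq_in _ _ _ mq v4_13; have p4 := neq_in _ _ _ mp v4_13.
have n_t (t : {set G}) : t \subset old A -> v1 \in t -> v3 \in t -> False.
  move=> /subsetP tA t1q t3; move/negP: pA; apply; move: mp.
  by rewrite !inE => /orP[]/eqP->; move: (tA _ t1q) (tA _ t3); rewrite !inE.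
pose T0 : {set H} := [set None; Some q; Some v2].
have T0t : is_triangle T0.
  apply: is_triangle3; rewrite /= ?inE ?eqxx ?orbT //.
    by move: mq; rewrite !inE => /orP[] ->; rewrite ?orbT.
  apply: dte_adj_old; first by rewrite adj_sym a2.
    by rewrite (negPf v2_13) andbF.
  by rewrite !inE (negPf q2) (negPf q4).
have T0A : T0 \subset A.
  by move: qA v2A; rewrite !inE !subUset !sub1set nA => -> ->.
apply/card_gt1P; exists T0.
have keep (t : {set G}) :
    t \in [set t : {set G} | is_triangle t & t \subset old A] ->
    ~~ ((v2 \in t) && (v4 \in t)) ->
    exists T : {set H},
      [/\ T \in [set t : {set H} | is_triangle t & t \subset A] & T0 != T].
  rewrite inE => /andP[tt tA] n24t; exists (Some @: t); split; last first.
    apply/eqP => /setP/(_ None); rewrite !inE eqxx.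
    by move/esym => /imsetP[].
  rewrite inE triangle_old //=; last by apply/negP => /andP[]; exact: n_t.
  apply/subsetP => _ /imsetP[x xt ->]; have := subsetP tA x xt.
  by rewrite inE.
suff [T [TA T0T]] : exists T : {set H},
    [/\ T \in [set t : {set H} | is_triangle t & t \subset A]
      & T0 != T].
  by exists T; split=> //; rewrite inE T0t.
case: (boolP ((v2 \in t1) && (v4 \in t1))) => [/andP[v2t1 v4t1]|n1];
  last exact: keep t1A n1.
case: (boolP ((v2 \in t2) && (v4 \in t2))) => [/andP[v2t2 v4t2]|n2];
  last exact: keep t2A n2.
move: t1A t2A; rewrite !inE => /andP[tt1 t1A] /andP[tt2 t2A].
have [x1 [x12 x14 a1 E1]] := triangle_third tt1 v2t1 v4t1 n24.
have [x2 [x22 x24 a2' E2]] := triangle_third tt2 v2t2 v4t2 n24.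
have x1A : x1 \in old A by apply: (subsetP t1A); rewrite E1 !inE eqxx orbT.
have x2A : x2 \in old A by apply: (subsetP t2A); rewrite E2 !inE eqxx orbT.
have x1x2 : x1 != x2 by apply: contraNneq t12 => e; rewrite E1 E2 e.
have aq4 : adj q v4.
  (* Otherwise [x1, x2, q, p, v4] are five neighbours of [v2]. *)
  case: (eqVneq x1 q) => [e|x1q].
    by apply: triangle_adj tt1 _ v4t1 q4; rewrite E1 -e !inE eqxx orbT.
  case: (eqVneq x2 q) => [e|x2q].
    by apply: triangle_adj tt2 _ v4t2 q4; rewrite E2 -e !inE eqxx orbT.
  have : 5 <= edges [set v2] [set: G].
    apply: (@edges1_ge G v2 _ [:: x1; x2; q; p; v4]).
      rewrite /= !inE !negb_or x1x2 x1q x2q x14 x24 q4 p4 qp.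
      by rewrite (neq_in _ _ _ x1A pA) (neq_in _ _ _ x2A pA).
    by rewrite /= !inE a1 a2' a24 !a2.
  by rewrite edgesT // cards1.
exists ([set None; Some q; Some v4] : {set H}); split; last first.
  apply/eqP => /setP/(_ (Some v4)); rewrite !inE !(inj_eq Some_inj) /= eqxx orbT.
  by rewrite ![v4 == _]eq_sym (negPf q4) (negPf n24).
rewrite inE is_triangle3 /= ?inE ?eqxx ?orbT //=.
- by move: qA v4A; rewrite !inE !subUset !sub1set nA => -> ->.
- by move: mq; rewrite !inE => /orP[] ->; rewrite ?orbT.
apply: dte_adj_old => //; first by rewrite (negPf v4_13) andbF.
by rewrite !inE (negPf q2) (negPf q4).
Qed.

(** If both [v1, v3] or both [v2, v4] are outside, or if only [v2] is outside
    of the four, the original graph has a non-trivial cut of size at most four: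
    that of [old A], respectively of [old A] with [v2] added. *)
Lemma two_tri_new_in A :
  None \in A -> 5 <= #|A| -> 3 <= #|~: A| -> cut A <= 6 -> 1 < tri_in A.
Proof.
move=> nA; rewrite card_old cardC_old nA add0n !add1n ltnS => A4 A3 cA.
have [n12 n13 n14 [n23 n24 n34]] := site_neq.
have [_ /and3P[a12 a23 a13] a24] := site.
have no_cut4 : (cut (old A) <= 4) = false.
  apply/negP => /(sturdy_cuts stG)[] le1; first by have := leq_trans A4 le1.
  by have := leq_trans A3 le1.
have := cut_dte A; rewrite nA /= => F.
case v1A: (v1 \in old A) in F *; case v3A: (v3 \in old A) in F *.
- case v2A: (v2 \in old A) in F *.
    apply: two_triangles dte_double_triangle _.
    by move: v1A v2A v3A; rewrite !inE nA => -> -> ->.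
  case v4A: (v4 \in old A) in F *; last first.
    by move: F cA no_cut4; clear; rewrite /=; lia.
  have u134 : uniq [:: v1; v3; v4] by rewrite /= !inE negb_or n13 n14 n34.
  have M := cut_move_le regG (negbT v2A) u134 _.
  have {M} /= M :=
    M ltac:(by rewrite /= v1A v3A v4A [adj v2 v1]adj_sym a12 a23 a24).
  have /(sturdy_cuts stG)[] : cut (v2 |: old A) <= 4.
  + by move: F cA M; clear; rewrite /=; lia.
  + by rewrite cardsU1 v2A; move: A4; clear; lia.
  rewrite setCU setIC -setDE => le1; move: A3.
  by rewrite (cardsD1 v2) inE v2A /=; move: le1; clear; lia.
- have [/andP[v2A v4A]|b24] := boolP ((v2 \in old A) && (v4 \in old A)).
    apply: (@two_tri_shift _ v3 v1); rewrite ?v3A ?v1A ?v2A ?v4A //.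
      by rewrite setUC.
    apply: (sturdy_rich stG) => //.
    by rewrite v2A v4A in F; move: F cA; clear; rewrite /=; lia.
  apply: leq_trans (tri_in_old (subxx _) _ b24); last by rewrite v3A andbF.
  apply: (sturdy_rich stG) => //; move: F cA b24 no_cut4; clear.
  by case: (_ \in _); case: (_ \in _) => /=; lia.
- have [/andP[v2A v4A]|b24] := boolP ((v2 \in old A) && (v4 \in old A)).
    apply: (@two_tri_shift _ v1 v3); rewrite ?v3A ?v1A ?v2A ?v4A //.
    apply: (sturdy_rich stG) => //.
    by rewrite v2A v4A in F; move: F cA; clear; rewrite /=; lia.
  apply: leq_trans (tri_in_old (subxx _) _ b24); last by rewrite v1A.
  apply: (sturdy_rich stG) => //; move: F cA b24 no_cut4; clear.
  by case: (v2 \in _); case: (v4 \in _) => /=; lia.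
by move: F cA no_cut4; clear; case: (v2 \in _); case: (v4 \in _) => /=; lia.
Qed.

(** Both ends of a deleted edge cannot lie in [A], again because the old cut
    would be too small; so the triangles of [old A] survive.  The complement of
    [old A] may have only two vertices left. Then it contains one of [v1, v3]
    and one of [v2, v4], and some third vertex of the site in [old A] is
    adjacent to both; moving it out of [old A] does not enlarge the cut. *)
Lemma two_tri_new_notin A :
  None \notin A -> 5 <= #|A| -> 3 <= #|~: A| -> cut A <= 6 -> 1 < tri_in A.
Proof.
move=> nA; rewrite card_old cardC_old (negPf nA) add0n add1n ltnS => A5 A3 cA.
have [n12 n13 n14 [n23 n24 n34]] := site_neq.
have [_ /and3P[a12 a23 a13] a24] := site.
have no_cut4 : (cut (old A) <= 4) = false.
  apply/negP => /(sturdy_cuts stG)[] le1; first by have := leq_trans A5 le1.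
  by have := leq_trans A3 le1.
have F := cut_dte A; rewrite (negPf nA) /= in F.
have n13A : ~~ ((v1 \in old A) && (v3 \in old A)).
  apply/andP => -[v1A v3A]; rewrite v1A v3A in F; move: F cA no_cut4; clear.
  by case: (v2 \in _); case: (v4 \in _) => /=; lia.
have n24A : ~~ ((v2 \in old A) && (v4 \in old A)).
  apply/andP => -[v2A v4A]; rewrite v2A v4A in F; move: F cA no_cut4; clear.
  by case: (v1 \in _); case: (v3 \in _) => /=; lia.
apply: leq_trans (tri_in_old (subxx _) n13A n24A).
have c6 : cut (old A) <= 6.
  move: F cA n13A n24A; clear.
  case: (v1 \in _); case: (v2 \in _); case: (v3 \in _); case: (v4 \in _);
  by move=> /=; lia.
have [A3'|] := leqP 3 #|~: old A|.
  exact: (sturdy_rich stG) (ltnW A5) A3' c6.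
rewrite ltnS => A2.
have drop r p q : r \in old A -> p \notin old A -> q \notin old A -> p != q ->
    adj r p -> adj r q -> 1 < tri_in (old A).
  move=> rA pA qA pq rp rq; apply: leq_trans (tri_in_subset (subD1set (old A) r)).
  have rC : r \notin ~: old A by rewrite in_setC rA.
  have E : ~: (old A :\ r) = r |: ~: old A by rewrite setCD setUC.
  have upq : uniq [:: p; q] by rewrite /= inE pq.
  have M := cut_move_le regG rC upq _.
  have {M} /= M := M ltac:(by rewrite /= !in_setC pA qA rp rq).
  apply: (sturdy_rich stG).
  - by move: A5; rewrite (cardsD1 r (old A)) rA.
  - by rewrite E cardsU1 rC; move: A3; clear; lia.
  by rewrite -cutC E; move: M c6; rewrite cutC; clear; lia.
have in3 x y z : x \notin old A -> y \notin old A -> z \notin old A ->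
    uniq [:: x; y; z] -> False.
  move=> xA yA zA u3; suff : 3 <= #|~: old A| by rewrite leqNgt ltnS A2.
  apply/card_geqP; exists [:: x; y; z]; split=> // w.
  by rewrite in_setC !in_cons in_nil orbF => /or3P[] /eqP->.
have a21 : adj v2 v1 by rewrite adj_sym.
case v2A: (v2 \in old A) in n24A *.
  have v4A : v4 \notin old A by [].
  have [v1A|v1A] := boolP (v1 \in old A).
    by apply: (drop v2 v3 v4); rewrite ?v2A //; move: n13A; rewrite v1A.
  by apply: (drop v2 v1 v4); rewrite ?v2A.
have {}v2A := negbT v2A.
have [v1A|v1A] := boolP (v1 \in old A).
  by apply: (drop v1 v2 v3) => //; move: n13A; rewrite v1A.
have [v3A|v3A] := boolP (v3 \in old A).
  by apply: (drop v3 v2 v1); rewrite // ?(adj_sym v3) // eq_sym.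
by case: (in3 v1 v2 v3) => //; rewrite /= !inE negb_or n12 n13 n23.
Qed.

Lemma dte_rich_sides : rich_sides H.
Proof.
move=> A A4 A3 cA; have [/esym A4e|A4n] := eqVneq #|A| 4.
  exact: two_tri_card4 dte_regular _ cA.
have A5 : 5 <= #|A| by rewrite ltn_neqAle eq_sym A4n.
have [nA|nA] := boolP (None \in A); first exact: two_tri_new_in.
exact: two_tri_new_notin.
Qed.

Lemma sturdy_dte : sturdy H.
Proof.
split; [exact: dte_regular | | exact: dte_small_cuts_trivial | exact: dte_rich_sides].
by exists (Some v2), None, (Some v1), (Some v3); exact: dte_double_triangle.
Qed.

End Expansion.

(** * Counting triangles *)

Section Counting.
Variables (G : sgraph) (regG : regular 4 G).

Lemma common_neighbour (x y : G) :
  #|G| <= 7 -> exists z, adj x z && adj y z.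
Proof.
move=> G7; pose N (u : G) := [set z | adj u z].
have : 0 < #|N x :&: N y|.
  have := cardsUI (N x) (N y); rewrite !regG; have := max_card (N x :|: N y).
  by move: (#|_ :|: _|) (#|_ :&: _|) G7 => m n; lia.
by case/card_gt0P => z; rewrite !inE; exists z.
Qed.

(** Every ordered pair of adjacent vertices lies in some triangle, and a
    triangle accounts for six such pairs, of which there are at least twenty.
    The vertex [x0] only ensures that the graph is non-empty. *)
Lemma four_tri_small (x0 : G) : #|G| <= 7 -> 4 <= tri G.
Proof.
move=> G7; have G5 : 5 <= #|G|.
  have : #|[set y | adj x0 y]| < #|[set: G]|.
    by apply: proper_card; rewrite properT; apply: contraFneq (adj_irrefl x0);
      move/setP/(_ x0); rewrite !inE.
  by rewrite regG cardsT.
suff : 4 * #|G| <= tri G * 6 by lia.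
rewrite -cardsT -(edgesT regG) -sum_nat_const.
apply: (@leq_trans (\sum_(t in [set t : {set G} | is_triangle t]) edges t t)).
  under [leqRHS]eq_bigr => t _ do rewrite edges_sum.
  rewrite edges_sum [leqRHS]exchange_big; apply: leq_sum => x _.
  rewrite [leqRHS]exchange_big; apply: leq_sum => y _; rewrite !inE.
  case xy: (adj x y) => //; have [z /andP[xz yz]] := common_neighbour x y G7.
  rewrite (bigD1 [set x; y; z]) ?inE ?is_triangle3 //=.
  by rewrite !eqxx orbT.
apply: leq_sum => t; rewrite inE => /card_triangle t3.
by apply: leq_trans (edges_inner t) _; rewrite t3.
Qed.

End Counting.

Lemma sturdy_K5_descendant (G : sgraph) : K5_descendant G -> sturdy G.
Proof.
elim=> [|K v1 v2 v3 v4 _ stK _ site|K L _ stK isoKL].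
- exact: sturdy_K5.
- exact: sturdy_dte stK site.
exact: sturdy_iso isoKL stK.
Qed.

Theorem theorem4p10 (G : sgraph) : K5_descendant G -> 4 <= tri G.
Proof.
move=> /sturdy_K5_descendant[regG [p [q [r [s pqrs]]]] _ richG].
have [G7|G8] := leqP #|G| 7; first exact: four_tri_small regG p G7.
have [D memD [D4 cD]] := cut_double_triangle regG pqrs.
have D'4 : 4 <= #|~: D| by have := cardsC D; rewrite D4; move: G8; clear; lia.
apply: leq_trans (tri_in_disjoint D).
apply: (@leq_add 2 2); first exact: two_triangles pqrs memD.
by apply: richG => //; rewrite ?setCK ?D4 ?cutC.
Qed.
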